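(* Let $\mathcal{F}$ be a commutative square of commutative unital rings with maps $g_1: R \to R_1$, $g_2: R \to R_2$, $h_1: R_1 \to S$, $h_2: R_2 \to S$, $h_1 g_1 = h_2 g_2$. Let $\mathcal{C}$ be a full subcategory of $R\text{-mod}$ and $\mathcal{D}$ a full subcategory of the category of patching data $\mathbf{PD}(\mathcal{F})$, and assume that the functors $\mathbf{F}_{\mathcal{F}}$ and $\mathbf{G}_{\mathcal{F}}$ induce mutually inverse equivalences between $\mathcal{C}$ and $\mathcal{D}$. Suppose that: - $R \in \mathcal{C}$; - $(R_1^2, R_2^2, X) \in \mathcal{D}$ for every $X \in \mathrm{GL}_2(S)$; - $I \in \mathcal{C}$ for every ideal $I \subset R$ which is (as an $R$-module) a quotient of some $M \in \mathcal{C}$. Then $\mathcal{F}$ is cartesian and surjective.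
   Context: The square $\mathcal{F}$ is cartesian if the sequence $0 \to R \xrightarrow{\varphi} R_1 \oplus R_2 \xrightarrow{\psi} S$ is exact, where $\varphi(r) = (g_1(r), g_2(r))$ and $\psi(r_1, r_2) = h_1(r_1) - h_2(r_2)$; it is surjective if $\psi$ is surjective. The category of patching data $\mathbf{PD}(\mathcal{F})$ has as objects triples $(M_1, M_2, \zeta)$ with $M_i$ an $R_i$-module ($i=1,2$) and $\zeta: M_1 \otimes_{R_1} S \to M_2 \otimes_{R_2} S$ an isomorphism of $S$-modules; morphisms $(M_1, M_2, \zeta) \to (M_1', M_2', \zeta')$ are pairs $(f_1, f_2)$ of $R_i$-linear maps $f_i: M_i \to M_i'$ with $\zeta' \circ (f_1 \otimes 1) = (f_2 \otimes 1) \circ \zeta$. A matrix $X \in \mathrm{GL}_2(S)$ is regarded as an isomorphism $R_1^2 \otimes_{R_1} S = S^2 \to S^2 = R_2^2 \otimes_{R_2} S$. Define the functors $$\mathbf{F}_{\mathcal{F}}: R\text{-mod} \to \mathbf{PD}(\mathcal{F}),\quad M \mapsto (M \otimes_R R_1, M \otimes_R R_2, \mathrm{id}_{M \otimes_R S}),$$ $$\mathbf{G}_{\mathcal{F}}: \mathbf{PD}(\mathcal{F}) \to R\text{-mod},\quad (M_1, M_2, \zeta) \mapsto \{(m_1, m_2) \in M_1 \oplus M_2 : \zeta(m_1 \otimes 1) = m_2 \otimes 1\}.$$ That they induce mutually inverse equivalences between $\mathcal{C}$ and $\mathcal{D}$ means that $\mathbf{F}_{\mathcal{F}}$ restricts to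 a functor $\mathcal{C} \to \mathcal{D}$, $\mathbf{G}_{\mathcal{F}}$ restricts to a functor $\mathcal{D} \to \mathcal{C}$, and the two composites of these restrictions are naturally isomorphic to the identity functors of $\mathcal{C}$ and $\mathcal{D}$. *)

(* Defs.v *)
From HB Require Import structures.
From mathcomp Require Import all_boot all_order all_algebra.
From mathcomp Require Import boolp.

Set Implicit Arguments.
Unset Strict Implicit.
Unset Printing Implicit Defensive.

Import GRing.Theory.
Local Open Scope ring_scope.
Local Open Scope quotient_scope.

Record category := Category {
  obj :> Type;
  hom : obj -> obj -> Type;
  idm : forall x, hom x x;
  comp : forall x y z, hom y z -> hom x y -> hom x z;
  comp1m : forall x y (u : hom x y), comp (idm y) u = u;
  compm1 : forall x y (u : hom x y), comp u (idm x) = u;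
  compA : forall x y z t (u : hom z t) (v : hom y z) (w : hom x y),
    comp u (comp v w) = comp (comp u v) w
}.

Arguments hom {c} x y.
Arguments idm {c} x.
Arguments comp {c x y z} u v.

Definition is_iso (C : category) (x y : C) (u : hom x y) : Prop :=
  exists v : hom y x, comp v u = idm x /\ comp u v = idm y.

Record functor (C D : category) := Functor {
  fobj :> C -> D;
  fmap : forall x y, hom x y -> hom (fobj x) (fobj y);
  fmap1 : forall x, fmap (idm x) = idm (fobj x);
  fmapM : forall x y z (u : hom y z) (v : hom x y),
    fmap (comp u v) = comp (fmap u) (fmap v)
}.

Arguments fmap {C D} f {x y} u.

Definition idF (C : category) : functor C C :=
  @Functor C C (fun x => x) (fun x y u => u)
    (fun x => erefl) (fun x y z u v => erefl).

Lemma compF_fmap1 (C D E : category) (G : functor D E) (F : functor C D) x :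
  fmap G (fmap F (idm x)) = idm (G (F x)).
Proof. by rewrite !fmap1. Qed.

Lemma compF_fmapM (C D E : category) (G : functor D E) (F : functor C D)
    x y z (u : hom y z) (v : hom x y) :
  fmap G (fmap F (comp u v)) = comp (fmap G (fmap F u)) (fmap G (fmap F v)).
Proof. by rewrite !fmapM. Qed.

Definition compF (C D E : category) (G : functor D E) (F : functor C D) :
    functor C E :=
  @Functor C E (fun x => G (F x)) (fun x y u => fmap G (fmap F u))
    (compF_fmap1 G F) (@compF_fmapM C D E G F).

Definition naturally_isomorphic (C D : category) (F G : functor C D) : Prop :=
  exists eta : forall x : C, hom (F x) (G x),
    (forall x, is_iso (eta x)) /\
    (forall (x y : C) (u : hom x y),
       comp (eta y) (fmap F u) = comp (fmap G u) (eta x)).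

Definition full_subcategory (C : category) (P : C -> Prop) : category :=
  @Category {x : C | P x} (fun x y => hom (sval x) (sval y))
    (fun x => idm (sval x)) (fun x y z u v => comp u v)
    (fun x y u => comp1m u) (fun x y u => compm1 u)
    (fun x y z t u v w => compA u v w).

Definition restrict_functor (C D : category) (F : functor C D)
    (P : C -> Prop) (Q : D -> Prop) (FPQ : forall x, P x -> Q (F x)) :
    functor (full_subcategory P) (full_subcategory Q) :=
  @Functor (full_subcategory P) (full_subcategory Q)
    (fun x => exist Q (F (sval x)) (FPQ (sval x) (svalP x)))
    (fun x y u => fmap F u) (fun x => fmap1 F (sval x))
    (fun x y z u v => fmapM F u v).

Definition induce_inverse_equivalences (C D : category)
    (F : functor C D) (G : functor D C) (P : C -> Prop) (Q : D -> Prop) : Prop :=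
  exists (FPQ : forall x, P x -> Q (F x)) (GQP : forall y, Q y -> P (G y)),
    let F' := restrict_functor FPQ in
    let G' := restrict_functor GQP in
    naturally_isomorphic (compF G' F') (idF (full_subcategory P)) /\
    naturally_isomorphic (compF F' G') (idF (full_subcategory Q)).

Lemma linear_ext (A : pzRingType) (U V : lmodType A) (f g : {linear U -> V}) :
  f =1 g -> f = g.
Proof.
move=> fg; have {fg} : (f : U -> V) = g by apply/funext.
case: f g => f [[f1] [f2]] [g [[g1] [g2]]] /= E.
case: g / E g1 g2 => g1 g2.
by rewrite (Prop_irrelevance f1 g1) (Prop_irrelevance f2 g2).
Qed.

Section ModuleCategory.
Variable A : pzRingType.

Definition lin_id (U : lmodType A) : {linear U -> U} := idfun.
Definition lin_comp (U V W : lmodType A)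
  (u : {linear V -> W}) (v : {linear U -> V}) : {linear U -> W} := u \o v.

Lemma lin_compE (U V W : lmodType A) (u : {linear V -> W})
  (v : {linear U -> V}) x : lin_comp u v x = u (v x).
Proof. by []. Qed.

Lemma lin_idE (U : lmodType A) x : lin_id U x = x.
Proof. by []. Qed.

Lemma lin_comp1m (U V : lmodType A) (u : {linear U -> V}) :
  lin_comp (lin_id V) u = u.
Proof. exact: linear_ext. Qed.
Lemma lin_compm1 (U V : lmodType A) (u : {linear U -> V}) :
  lin_comp u (lin_id U) = u.
Proof. exact: linear_ext. Qed.
Lemma lin_compA (U V W T : lmodType A) (u : {linear W -> T})
    (v : {linear V -> W}) (w : {linear U -> V}) :
  lin_comp u (lin_comp v w) = lin_comp (lin_comp u v) w.
Proof. exact: linear_ext. Qed.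

Definition module_category : category :=
  @Category (lmodType A) (fun U V => {linear U -> V}) lin_id lin_comp
    lin_comp1m lin_compm1 lin_compA.
End ModuleCategory.

(* Restriction of scalars along f. *)
Definition restr (A B : pzRingType) (f : {rmorphism A -> B})
  (N : lmodType B) : Type := N.

Section Restriction.
Variables (A B : pzRingType) (f : {rmorphism A -> B}) (N : lmodType B).

HB.instance Definition _ := GRing.Zmodule.on (restr f N).

Definition restr_scale (a : A) (n : restr f N) : restr f N := f a *: (n : N).

Lemma restr_scaleA a b n :
  restr_scale a (restr_scale b n) = restr_scale (a * b) n.
Proof. by rewrite /restr_scale scalerA rmorphM. Qed.
Lemma restr_scale1 : left_id 1 restr_scale.
Proof. by move=> n; rewrite /restr_scale rmorph1 scale1r. Qed.
Lemma restr_scaleDr : right_distributive restr_scale +%R.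
Proof. by move=> a m n; rewrite /restr_scale scalerDr. Qed.
Lemma restr_scaleDl n : {morph restr_scale^~ n : a b / a + b}.
Proof. by move=> a b; rewrite /restr_scale rmorphD scalerDl. Qed.

HB.instance Definition _ := GRing.Zmodule_isLmodule.Build A (restr f N)
  restr_scaleA restr_scale1 restr_scaleDr restr_scaleDl.

Lemma restrZ (a : A) (n : restr f N) : a *: n = f a *: (n : N).
Proof. by []. Qed.
End Restriction.

Section BaseChange.
Variables (A B : comPzRingType) (f : {rmorphism A -> B}) (M : lmodType A).

(* A list of pairs (m, b) stands for the sum of the m (x) b; lists suffice for *)
(* the tensor product of abelian groups because - (m (x) b) = (- m) (x) b. *)
Inductive tensor_rel : seq (M * B) -> seq (M * B) -> Prop :=
| tensor_refl s : tensor_rel s s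
| tensor_sym s t : tensor_rel s t -> tensor_rel t s
| tensor_trans s t u : tensor_rel s t -> tensor_rel t u -> tensor_rel s u
| tensor_cat s s' t t' :
    tensor_rel s s' -> tensor_rel t t' -> tensor_rel (s ++ t) (s' ++ t')
| tensor_catC s t : tensor_rel (s ++ t) (t ++ s)
| tensor_zero b : tensor_rel [:: (0, b)] [::]
| tensor_addl m m' b : tensor_rel [:: (m + m', b)] [:: (m, b); (m', b)]
| tensor_addr m b b' : tensor_rel [:: (m, b + b')] [:: (m, b); (m, b')]
| tensor_scale a m b : tensor_rel [:: (a *: m, b)] [:: (m, f a * b)].

Definition tensor_eq (s t : seq (M * B)) : bool := `[< tensor_rel s t >].

Lemma tensor_eq_refl : reflexive tensor_eq.
Proof. by move=> s; apply/asboolP; apply: tensor_refl. Qed.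
Lemma tensor_eq_sym : symmetric tensor_eq.
Proof. by move=> s t; apply/asboolP/asboolP; apply: tensor_sym. Qed.
Lemma tensor_eq_trans : transitive tensor_eq.
Proof.
move=> t s u /asboolP st /asboolP tu; apply/asboolP.
exact: tensor_trans st tu.
Qed.

Canonical tensor_equiv :=
  EquivRel tensor_eq tensor_eq_refl tensor_eq_sym tensor_eq_trans.

(* The tensor product M (x)_A B, where B is an A-algebra through f. *)
Definition base_change : Type := {eq_quot tensor_equiv}.

HB.instance Definition _ : EqQuotient _ tensor_eq base_change :=
  EqQuotient.on base_change.
HB.instance Definition _ := Choice.on base_change.

Definition bc_class (s : seq (M * B)) : base_change := \pi_base_change s.

Lemma bc_classP s t : tensor_rel s t -> bc_class s = bc_class t.
Proof. by move=> st; apply/eqmodP/asboolP. Qed.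

Lemma bc_class_inj s t : bc_class s = bc_class t -> tensor_rel s t.
Proof. by move=> /eqmodP/asboolP. Qed.

Lemma bc_repr (x : base_change) : bc_class (repr x) = x.
Proof. exact: reprK. Qed.

Lemma bc_rel_repr s : tensor_rel (repr (bc_class s)) s.
Proof. by apply: bc_class_inj; rewrite bc_repr. Qed.

Definition bc_add (x y : base_change) : base_change :=
  bc_class (repr x ++ repr y).
Definition bc_opp (x : base_change) : base_change :=
  bc_class [seq (- p.1, p.2) | p <- repr x].
Definition bc_scale (c : B) (x : base_change) : base_change :=
  bc_class [seq (p.1, c * p.2) | p <- repr x].

Lemma tensor_rel_opp s t : tensor_rel s t ->
  tensor_rel [seq (- p.1, p.2) | p <- s] [seq (- p.1, p.2) | p <- t].
Proof.
elim=> {s t} /=.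
- by move=> s; apply: tensor_refl.
- by move=> s t _; apply: tensor_sym.
- by move=> s t u _ st _; apply: tensor_trans.
- by move=> s s' t t' _ ss _ tt; rewrite !map_cat; apply: tensor_cat.
- by move=> s t; rewrite !map_cat; apply: tensor_catC.
- by move=> b; rewrite oppr0; apply: tensor_zero.
- by move=> m m' b; rewrite opprD; apply: tensor_addl.
- by move=> m b b'; apply: tensor_addr.
- by move=> a m b; rewrite -scalerN; apply: tensor_scale.
Qed.

Lemma tensor_rel_scale c s t : tensor_rel s t ->
  tensor_rel [seq (p.1, c * p.2) | p <- s] [seq (p.1, c * p.2) | p <- t].
Proof.
elim=> {s t} /=.
- by move=> s; apply: tensor_refl.
- by move=> s t _; apply: tensor_sym.
- by move=> s t u _ st _; apply: tensor_trans.
- by move=> s s' t t' _ ss _ tt; rewrite !map_cat; apply: tensor_cat.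
- by move=> s t; rewrite !map_cat; apply: tensor_catC.
- by move=> b; apply: tensor_zero.
- by move=> m m' b; apply: tensor_addl.
- by move=> m b b'; rewrite mulrDr; apply: tensor_addr.
- by move=> a m b; rewrite mulrCA; apply: tensor_scale.
Qed.

Lemma bc_addE s t : bc_add (bc_class s) (bc_class t) = bc_class (s ++ t).
Proof. by apply: bc_classP; apply: tensor_cat; apply: bc_rel_repr. Qed.

Lemma bc_oppE s : bc_opp (bc_class s) = bc_class [seq (- p.1, p.2) | p <- s].
Proof. by apply/bc_classP/tensor_rel_opp/bc_rel_repr. Qed.

Lemma bc_scaleE c s :
  bc_scale c (bc_class s) = bc_class [seq (p.1, c * p.2) | p <- s].
Proof. by apply/bc_classP/tensor_rel_scale/bc_rel_repr. Qed.

Lemma bc_addA : associative bc_add.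
Proof.
move=> x y z; rewrite -(bc_repr x) -(bc_repr y) -(bc_repr z).
by rewrite !bc_addE catA.
Qed.

Lemma bc_addC : commutative bc_add.
Proof. by move=> x y; apply/bc_classP/tensor_catC. Qed.

Lemma bc_add0 : left_id (bc_class [::]) bc_add.
Proof. by move=> x; rewrite -(bc_repr x) bc_addE. Qed.

Lemma bc_addN : left_inverse (bc_class [::]) bc_opp bc_add.
Proof.
move=> x; rewrite -(bc_repr x) bc_oppE bc_addE; apply: bc_classP.
elim: (repr x) => [|[m b] s IH] /=; first exact: tensor_refl.
set t := [seq _ | _ <- s] in IH *.
apply: (@tensor_trans _ ([:: (- m, b); (m, b)] ++ (t ++ s))).
  apply: (@tensor_cat [:: _] [:: _] _ ((m, b) :: t ++ s)).
    exact: tensor_refl.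
  rewrite -[_ :: s]cat1s -[_ :: t ++ s]cat1s !catA.
  apply: tensor_cat; [exact: tensor_catC | exact: tensor_refl].
apply: (@tensor_cat _ [::] _ [::]) => //.
apply: tensor_trans (tensor_sym (tensor_addl _ _ _)) _.
by rewrite addNr; apply: tensor_zero.
Qed.

HB.instance Definition _ :=
  GRing.isZmodule.Build base_change bc_addA bc_addC bc_add0 bc_addN.

Lemma bc_class_cat s t : bc_class (s ++ t) = bc_class s + bc_class t.
Proof. by rewrite -bc_addE. Qed.

Lemma bc_scaleA a b x : bc_scale a (bc_scale b x) = bc_scale (a * b) x.
Proof.
rewrite -(bc_repr x) !bc_scaleE -map_comp; congr bc_class.
by apply: eq_map => p /=; rewrite mulrA.
Qed.

Lemma bc_scale1 : left_id 1 bc_scale.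
Proof.
move=> x; rewrite -{2}(bc_repr x); congr bc_class.
by rewrite -[RHS]map_id; apply: eq_map => -[m b] /=; rewrite mul1r.
Qed.

Lemma bc_scaleDr : right_distributive bc_scale +%R.
Proof.
move=> c x y; rewrite -(bc_repr x) -(bc_repr y) -bc_class_cat !bc_scaleE.
by rewrite -bc_class_cat map_cat.
Qed.

Lemma bc_scaleDl x : {morph bc_scale^~ x : a b / a + b}.
Proof.
move=> a b; rewrite -(bc_repr x) !bc_scaleE; elim: (repr x) => [|[m c] s IH].
  by rewrite /= -bc_class_cat.
rewrite /= -![_ :: map _ _]cat1s !bc_class_cat IH addrACA; congr (_ + _).
by rewrite mulrDl (bc_classP (tensor_addr _ _ _)) -bc_class_cat.
Qed.

HB.instance Definition _ := GRing.Zmodule_isLmodule.Build B base_change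
  bc_scaleA bc_scale1 bc_scaleDr bc_scaleDl.

Definition tens (m : M) (b : B) : base_change := bc_class [:: (m, b)].

Lemma tensDl m m' b : tens (m + m') b = tens m b + tens m' b.
Proof. by rewrite -bc_class_cat; apply/bc_classP/tensor_addl. Qed.

Lemma tensDr m b b' : tens m (b + b') = tens m b + tens m b'.
Proof. by rewrite -bc_class_cat; apply/bc_classP/tensor_addr. Qed.

Lemma tensZl a m b : tens (a *: m) b = tens m (f a * b).
Proof. exact/bc_classP/tensor_scale. Qed.

Lemma tensZr c m b : tens m (c * b) = c *: tens m b.
Proof. by rewrite [RHS]bc_scaleE. Qed.

Lemma tensE m b : tens m b = b *: tens m 1.
Proof. by rewrite -tensZr mulr1. Qed.

Definition tens1 (m : M) : restr f base_change := tens m 1.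

Lemma tens1_is_linear : linear tens1.
Proof. by move=> a u v; rewrite /tens1 tensDl tensZl tensZr. Qed.

HB.instance Definition _ :=
  GRing.isLinear.Build A M (restr f base_change) *:%R tens1 tens1_is_linear.

Lemma bc_class_sum s : bc_class s = \sum_(p <- s) tens p.1 p.2.
Proof.
elim: s => [|[m b] s IH]; first by rewrite big_nil.
by rewrite big_cons -IH -bc_class_cat.
Qed.

Lemma bc_ind (P : base_change -> Prop) :
  P 0 -> (forall x y, P x -> P y -> P (x + y)) ->
  (forall m b, P (tens m b)) -> forall x, P x.
Proof.
move=> P0 PD Pt x; rewrite -(bc_repr x) bc_class_sum.
by elim/big_ind: _.
Qed.

Lemma bc_ext (N : lmodType B) (u v : {linear base_change -> N}) :
  (forall m, u (tens m 1) = v (tens m 1)) -> u = v.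
Proof.
move=> uv; apply: linear_ext => x; rewrite -(bc_repr x) bc_class_sum !raddf_sum.
by apply: eq_bigr => p _; rewrite tensE /= !linearZ_LR /= uv.
Qed.

Section Lift.
Variables (N : lmodType B) (u : {linear M -> restr f N}).

Definition bc_lift_fun (x : base_change) : N :=
  \sum_(p <- repr x) p.2 *: (u p.1 : N).

Lemma bc_lift_class s :
  bc_lift_fun (bc_class s) = \sum_(p <- s) p.2 *: (u p.1 : N).
Proof.
suff E t t' : tensor_rel t t' ->
    \sum_(p <- t) p.2 *: (u p.1 : N) = \sum_(p <- t') p.2 *: (u p.1 : N).
  exact/E/bc_rel_repr.
elim=> {t t'}.
- by [].
- by move=> t t' _ ->.
- by move=> t t' t'' _ -> _ ->.
- by move=> t t' r r' _ E _ E'; rewrite !big_cat E E'.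
- by move=> t t'; rewrite !big_cat /= addrC.
- by move=> b; rewrite big_seq1 big_nil /= raddf0 scaler0.
- by move=> m m' b; rewrite !big_cons !big_nil !addr0 /= raddfD scalerDr.
- by move=> m b b'; rewrite !big_cons !big_nil !addr0 /= scalerDl.
- by move=> a m b; rewrite !big_seq1 /= linearZ_LR restrZ scalerA mulrC.
Qed.

Lemma bc_lift_is_linear : linear bc_lift_fun.
Proof.
move=> c x y; rewrite -(bc_repr x) -(bc_repr y).
rewrite [_ *: bc_class _]bc_scaleE -bc_class_cat !bc_lift_class big_cat big_map.
congr (_ + _); rewrite scaler_sumr.
by apply: eq_bigr => p _; rewrite scalerA.
Qed.

HB.instance Definition _ :=
  GRing.isLinear.Build B base_change N *:%R bc_lift_fun bc_lift_is_linear.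

(* m (x) b |-> b *: u m *)
Definition bc_lift : {linear base_change -> N} := bc_lift_fun.

Lemma bc_lift_tens m b : bc_lift (tens m b) = b *: (u m : N).
Proof. by rewrite [LHS]bc_lift_class big_seq1. Qed.

Lemma bc_lift_tens1 m : bc_lift (tens m 1) = u m.
Proof. by rewrite bc_lift_tens scale1r. Qed.
End Lift.
End BaseChange.

Lemma bc_ext2 (A B C : comPzRingType) (f : {rmorphism A -> B})
    (g : {rmorphism B -> C}) (M : lmodType A) (N : lmodType C)
    (u v : {linear base_change g (base_change f M) -> N}) :
  (forall m, u (tens g (tens f m 1) 1) = v (tens g (tens f m 1) 1)) -> u = v.
Proof.
move=> uv; apply: bc_ext => x; rewrite -(bc_repr x) bc_class_sum.
rewrite -[tens g _ 1]/(tens1 g _) !raddf_sum; apply: eq_bigr => p _.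
by rewrite tensE /= /tens1 tensZl tensZr !linearZ_LR /= uv.
Qed.

Section BaseChangeMap.
Variables (A B : comPzRingType) (f : {rmorphism A -> B}).

(* u (x) 1 : M (x)_A B -> M' (x)_A B *)
Definition bc_map (M M' : lmodType A) (u : {linear M -> M'}) :
    {linear base_change f M -> base_change f M'} :=
  bc_lift (lin_comp (@tens1 A B f M') u).

Lemma bc_map_tens (M M' : lmodType A) (u : {linear M -> M'}) m b :
  bc_map u (tens f m b) = tens f (u m) b.
Proof. by rewrite bc_lift_tens -tensE. Qed.

Lemma bc_map1 (M : lmodType A) : bc_map (lin_id M) = lin_id (base_change f M).
Proof. by apply: bc_ext => m; rewrite bc_map_tens. Qed.

Lemma bc_mapM (M M' M'' : lmodType A) (u : {linear M' -> M''})
    (v : {linear M -> M'}) :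
  bc_map (lin_comp u v) = lin_comp (bc_map u) (bc_map v).
Proof. by apply: bc_ext => m; rewrite /= !bc_map_tens. Qed.
End BaseChangeMap.

Section Transitivity.
Variables (A B C : comPzRingType).
Variables (f : {rmorphism A -> B}) (g : {rmorphism B -> C}).
Variables (k : {rmorphism A -> C}) (kE : forall a, k a = g (f a)).
Variable M : lmodType A.

Definition bc_trans_inner (m : M) : restr f (restr g (base_change k M)) :=
  tens k m 1.

Lemma bc_trans_inner_is_linear : linear bc_trans_inner.
Proof. by move=> a u v; rewrite /bc_trans_inner tensDl tensZl kE tensZr. Qed.

HB.instance Definition _ := GRing.isLinear.Build A M
  (restr f (restr g (base_change k M))) *:%R
  bc_trans_inner bc_trans_inner_is_linear.

(* (m (x) b) (x) c |-> m (x) (g b * c) *)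
Definition bc_trans :
    {linear base_change g (base_change f M) -> base_change k M} :=
  bc_lift (bc_lift bc_trans_inner : {linear _ -> restr g (base_change k M)}).

Definition bc_trans_inv_inner (m : M) :
    restr k (base_change g (base_change f M)) := tens g (tens f m 1) 1.

Lemma bc_trans_inv_inner_is_linear : linear bc_trans_inv_inner.
Proof.
move=> a u v; rewrite /bc_trans_inv_inner !(tensDl, tensZl, tensZr, restrZ).
by rewrite kE.
Qed.

HB.instance Definition _ := GRing.isLinear.Build A M
  (restr k (base_change g (base_change f M))) *:%R
  bc_trans_inv_inner bc_trans_inv_inner_is_linear.

(* m (x) c |-> (m (x) 1) (x) c *)
Definition bc_trans_inv :
    {linear base_change k M -> base_change g (base_change f M)} :=
  bc_lift bc_trans_inv_inner.

Lemma bc_trans_tens m b c :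
  bc_trans (tens g (tens f m b) c) = tens k m (g b * c).
Proof.
rewrite bc_lift_tens bc_lift_tens restrZ scalerA mulrC -tensE //.
Qed.

Lemma bc_trans_inv_tens m c :
  bc_trans_inv (tens k m c) = tens g (tens f m 1) c.
Proof. by rewrite bc_lift_tens -tensE. Qed.

Lemma bc_transK : cancel bc_trans bc_trans_inv.
Proof.
suff E: lin_comp bc_trans_inv bc_trans = lin_id _.
  by move=> x; rewrite -[RHS]/(lin_id _ x) -E.
by apply: bc_ext2 => m; rewrite /= bc_trans_tens bc_trans_inv_tens rmorph1 mulr1.
Qed.

Lemma bc_trans_invK : cancel bc_trans_inv bc_trans.
Proof.
apply: bc_ind=> [|x y IHx IHy|m c]; rewrite ?(raddf0, raddfD) /= ?IHx ?IHy //.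
by rewrite bc_trans_inv_tens bc_trans_tens rmorph1 mul1r.
Qed.

Lemma bc_trans_bij : bijective bc_trans.
Proof. exact: Bijective bc_transK bc_trans_invK. Qed.

Lemma bc_trans_inv_bij : bijective bc_trans_inv.
Proof. exact: Bijective bc_trans_invK bc_transK. Qed.
End Transitivity.

Section FreeModule.
Variables (A B : comPzRingType) (f : {rmorphism A -> B}) (n : nat).

Definition bc_free_inner (v : 'cV[A]_n) : restr f 'cV[B]_n := map_mx f v.

Lemma bc_free_inner_is_linear : linear bc_free_inner.
Proof.
move=> a u v; rewrite restrZ; apply/matrixP=> i j.
by rewrite !mxE rmorphD rmorphM.
Qed.

HB.instance Definition _ := GRing.isLinear.Build A 'cV[A]_n
  (restr f 'cV[B]_n) *:%R bc_free_inner bc_free_inner_is_linear.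

(* v (x) b |-> b *: f v *)
Definition bc_free : {linear base_change f 'cV[A]_n -> 'cV[B]_n} :=
  bc_lift bc_free_inner.

Definition bc_free_inv_fun (w : 'cV[B]_n) : base_change f 'cV[A]_n :=
  \sum_(i < n) tens f (delta_mx i 0) (w i 0).

Lemma bc_free_inv_is_linear : linear bc_free_inv_fun.
Proof.
move=> c u v; rewrite /bc_free_inv_fun scaler_sumr -big_split.
by apply: eq_bigr => i _; rewrite !mxE tensDr tensZr.
Qed.

HB.instance Definition _ := GRing.isLinear.Build B 'cV[B]_n
  (base_change f 'cV[A]_n) *:%R bc_free_inv_fun bc_free_inv_is_linear.

Definition bc_free_inv : {linear 'cV[B]_n -> base_change f 'cV[A]_n} :=
  bc_free_inv_fun.

Lemma bc_free_tens v b : bc_free (tens f v b) = b *: map_mx f v.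
Proof. exact: bc_lift_tens. Qed.

Lemma bc_free_invK : cancel bc_free_inv bc_free.
Proof.
move=> w; rewrite [bc_free_inv w]/(bc_free_inv_fun w) raddf_sum.
apply/colP => i; rewrite summxE (bigD1 i) //= big1 ?addr0 => [|j ji].
  by rewrite bc_free_tens !mxE !eqxx rmorph1 mulr1.
by rewrite bc_free_tens !mxE eq_sym (negPf ji) rmorph0 mulr0.
Qed.

Lemma bc_freeK : cancel bc_free bc_free_inv.
Proof.
apply: bc_ind=> [|x y IHx IHy|v b]; rewrite ?(raddf0, raddfD) /= ?IHx ?IHy //.
rewrite bc_free_tens linearZ_LR tensE; congr (_ *: _).
have {2}->: v = \sum_(i < n) v i 0 *: delta_mx i 0.
  by rewrite {1}(matrix_sum_delta v); apply: eq_bigr => i _; rewrite big_ord1.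
rewrite -[tens f _ 1]/(tens1 f _) raddf_sum.
by apply: eq_bigr => i _; rewrite [RHS]tensZl mulr1 mxE.
Qed.

Lemma bc_free_bij : bijective bc_free.
Proof. exact: Bijective bc_freeK bc_free_invK. Qed.

Lemma bc_free_inv_bij : bijective bc_free_inv.
Proof. exact: Bijective bc_free_invK bc_freeK. Qed.
End FreeModule.

Record comm_square := CommSquare {
  sqR : comPzRingType;
  sqR1 : comPzRingType;
  sqR2 : comPzRingType;
  sqS : comPzRingType;
  g1 : {rmorphism sqR -> sqR1};
  g2 : {rmorphism sqR -> sqR2};
  h1 : {rmorphism sqR1 -> sqS};
  h2 : {rmorphism sqR2 -> sqS};
  sq_comm : forall r, h1 (g1 r) = h2 (g2 r)
}.

Definition sq_phi (F : comm_square) (r : sqR F) : sqR1 F * sqR2 F :=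
  (g1 F r, g2 F r).

Definition sq_psi (F : comm_square) (p : sqR1 F * sqR2 F) : sqS F :=
  h1 F p.1 - h2 F p.2.

Definition cartesian (F : comm_square) : Prop :=
  injective (@sq_phi F) /\
  (forall p, @sq_psi F p = 0 <-> exists r, sq_phi r = p).

Definition surjective_square (F : comm_square) : Prop :=
  forall s, exists p, @sq_psi F p = s.

Section PatchingData.
Variable F : comm_square.

Record patching_datum := PatchingDatum {
  pd1 : lmodType (sqR1 F);
  pd2 : lmodType (sqR2 F);
  pd_iso : {linear base_change (h1 F) pd1 -> base_change (h2 F) pd2};
  pd_iso_bij : bijective pd_iso
}.

Record patching_morphism (X Y : patching_datum) := PatchingMorphism {
  pm1 : {linear pd1 X -> pd1 Y};
  pm2 : {linear pd2 X -> pd2 Y};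
  pm_comm : forall x, pd_iso Y (bc_map (h1 F) pm1 x) =
                      bc_map (h2 F) pm2 (pd_iso X x)
}.

Lemma patching_morphism_ext X Y (u v : patching_morphism X Y) :
  pm1 u = pm1 v -> pm2 u = pm2 v -> u = v.
Proof.
case: u v => u1 u2 cu [v1 v2 cv] /= E1 E2; case: v1 / E1 cv => cv.
by case: v2 / E2 cv => cv; rewrite (Prop_irrelevance cu cv).
Qed.

Lemma pm_id_comm (X : patching_datum) x :
  pd_iso X (bc_map (h1 F) (lin_id (pd1 X)) x) =
  bc_map (h2 F) (lin_id (pd2 X)) (pd_iso X x).
Proof. by rewrite !bc_map1. Qed.

Definition pm_id (X : patching_datum) : patching_morphism X X :=
  PatchingMorphism (pm_id_comm (X := X)).

Lemma pm_comp_comm (X Y Z : patching_datum) (u : patching_morphism Y Z)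
    (v : patching_morphism X Y) x :
  pd_iso Z (bc_map (h1 F) (lin_comp (pm1 u) (pm1 v)) x) =
  bc_map (h2 F) (lin_comp (pm2 u) (pm2 v)) (pd_iso X x).
Proof. by rewrite !bc_mapM /= !pm_comm. Qed.

Definition pm_comp (X Y Z : patching_datum) (u : patching_morphism Y Z)
    (v : patching_morphism X Y) : patching_morphism X Z :=
  PatchingMorphism (pm_comp_comm u v).

Lemma pm_comp1m X Y (u : patching_morphism X Y) : pm_comp (pm_id Y) u = u.
Proof. by apply: patching_morphism_ext; apply: lin_comp1m. Qed.

Lemma pm_compm1 X Y (u : patching_morphism X Y) : pm_comp u (pm_id X) = u.
Proof. by apply: patching_morphism_ext; apply: lin_compm1. Qed.

Lemma pm_compA X Y Z T (u : patching_morphism Z T)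
    (v : patching_morphism Y Z) (w : patching_morphism X Y) :
  pm_comp u (pm_comp v w) = pm_comp (pm_comp u v) w.
Proof. by apply: patching_morphism_ext; apply: lin_compA. Qed.

Definition PD : category :=
  Category pm_comp1m pm_compm1 pm_compA.

Definition sq_diag : {rmorphism sqR F -> sqS F} := h1 F \o g1 F.

Lemma sq_diag1 r : sq_diag r = h1 F (g1 F r).
Proof. by []. Qed.

Lemma sq_diag2 r : sq_diag r = h2 F (g2 F r).
Proof. exact: sq_comm. Qed.

Section FObj.
Variable M : lmodType (sqR F).

(* The identity of M (x)_R S, read through the canonical isomorphisms *)
(* (M (x)_R R_i) (x)_(R_i) S = M (x)_R S. *)
Definition F_iso :
    {linear base_change (h1 F) (base_change (g1 F) M) ->
            base_change (h2 F) (base_change (g2 F) M)} :=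
  lin_comp (bc_trans_inv sq_diag2 M)
    (lin_comp (lin_id (base_change sq_diag M)) (bc_trans sq_diag1 M)).

Lemma F_iso_tens m b c :
  F_iso (tens _ (tens _ m b) c) = tens _ (tens _ m 1) (h1 F b * c).
Proof. by rewrite /F_iso !lin_compE lin_idE bc_trans_tens bc_trans_inv_tens. Qed.

Lemma F_iso_bij : bijective F_iso.
Proof.
exact: (bij_comp (bc_trans_inv_bij sq_diag2 M) (bc_trans_bij sq_diag1 M)).
Qed.

Definition F_obj : PD := PatchingDatum F_iso_bij.
End FObj.

Section FMap.
Variables (M M' : lmodType (sqR F)) (u : {linear M -> M'}).

Lemma F_map_comm x :
  F_iso M' (bc_map (h1 F) (bc_map (g1 F) u) x) =
  bc_map (h2 F) (bc_map (g2 F) u) (F_iso M x).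
Proof.
suff E: lin_comp (F_iso M') (bc_map (h1 F) (bc_map (g1 F) u)) =
        lin_comp (bc_map (h2 F) (bc_map (g2 F) u)) (F_iso M).
  by rewrite -[LHS]/(lin_comp _ _ x) E.
by apply: bc_ext2 => m; rewrite !lin_compE !lin_idE
  !(bc_map_tens, bc_trans_tens, bc_trans_inv_tens).
Qed.

Definition F_map : hom (F_obj M) (F_obj M') :=
  PatchingMorphism (X := F_obj M) (Y := F_obj M') F_map_comm.
End FMap.

Lemma F_map1 (M : lmodType (sqR F)) : F_map (lin_id M) = idm (F_obj M).
Proof. by apply: patching_morphism_ext; apply: bc_map1. Qed.

Lemma F_mapM (M M' M'' : lmodType (sqR F)) (u : {linear M' -> M''})
    (v : {linear M -> M'}) :
  F_map (lin_comp u v) = comp (F_map u) (F_map v).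
Proof. by apply: patching_morphism_ext; apply: bc_mapM. Qed.

Definition patching_F : functor (module_category (sqR F)) PD :=
  @Functor (module_category (sqR F)) PD F_obj F_map F_map1 F_mapM.

Section GObj.
Variable X : patching_datum.

Definition glue_pred : {pred restr (g1 F) (pd1 X) * restr (g2 F) (pd2 X)} :=
  [pred p | pd_iso X (tens (h1 F) p.1 1) == tens (h2 F) p.2 1].

Lemma glue_predP p :
  reflect (pd_iso X (tens (h1 F) p.1 1) = tens (h2 F) p.2 1) (p \in glue_pred).
Proof. exact: eqP. Qed.

Lemma glue_pred_submod : submod_closed glue_pred.
Proof.
split=> [|r p q /glue_predP Ep /glue_predP Eq]; apply/glue_predP.
  rewrite -[tens _ (0 : _ * _).1 1]/(tens1 _ 0).
  by rewrite -[tens _ (0 : _ * _).2 1]/(tens1 _ 0) !raddf0.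
rewrite /= !tensDl !restrZ !tensZl !tensZr raddfD /= linearZ_LR.
by rewrite Ep Eq sq_comm.
Qed.

HB.instance Definition _ := GRing.isSubmodClosed.Build (sqR F)
  (restr (g1 F) (pd1 X) * restr (g2 F) (pd2 X))%type glue_pred glue_pred_submod.

Definition glue : Type := {p | p \in glue_pred}.
HB.instance Definition _ := SubChoice.on glue.
HB.instance Definition _ := [SubChoice_isSubLmodule of glue by <:].
End GObj.

Section GMap.
Variables (X Y : patching_datum) (u : patching_morphism X Y).

Lemma G_map_subproof (p : glue X) :
  (pm1 u (val p).1, pm2 u (val p).2) \in @glue_pred Y.
Proof.
apply/glue_predP; rewrite /= -!bc_map_tens pm_comm.
by congr (bc_map _ _ _); apply/glue_predP/valP.
Qed.

Definition G_map_fun (p : glue X) : glue Y :=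
  exist (fun q => q \in @glue_pred Y) _ (G_map_subproof p).

Lemma G_map_is_linear : linear G_map_fun.
Proof.
move=> r p q; apply/val_inj; rewrite linearP /=.
by congr (_, _); rewrite restrZ linearP.
Qed.

HB.instance Definition _ := GRing.isLinear.Build (sqR F) (glue X) (glue Y)
  *:%R G_map_fun G_map_is_linear.

Definition G_map : {linear glue X -> glue Y} := G_map_fun.
End GMap.

Lemma G_map1 (X : patching_datum) : G_map (pm_id X) = lin_id (glue X).
Proof. by apply: linear_ext => p; apply/val_inj; rewrite /= -surjective_pairing. Qed.

Lemma G_mapM (X Y Z : patching_datum) (u : patching_morphism Y Z)
    (v : patching_morphism X Y) :
  G_map (pm_comp u v) = lin_comp (G_map u) (G_map v).
Proof. by apply: linear_ext => p; apply/val_inj. Qed.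

Definition patching_G : functor PD (module_category (sqR F)) :=
  @Functor PD (module_category (sqR F)) (fun X => glue X : lmodType _)
    G_map G_map1 G_mapM.
End PatchingData.

(* unitmx requires a comUnitRingType, which would fix a choice of inverses on S. *)
Definition invertible_mx (S : comPzRingType) (n : nat) (X : 'M[S]_n) : Prop :=
  exists Y : 'M[S]_n, X *m Y = 1%:M /\ Y *m X = 1%:M.

Section FreeDatum.
Variables (F : comm_square) (n : nat) (X : 'M[sqS F]_n).

Definition free_iso :
    {linear base_change (h1 F) 'cV[sqR1 F]_n ->
            base_change (h2 F) 'cV[sqR2 F]_n} :=
  lin_comp (bc_free_inv (h2 F) n)
    (lin_comp (mulmx X : {linear 'cV_n -> 'cV_n}) (bc_free (h1 F) n)).

Hypothesis Xinv : invertible_mx X.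

Lemma free_iso_bij : bijective free_iso.
Proof.
have [Y [XY YX]] := Xinv.
apply: (bij_comp (bc_free_inv_bij _ _)).
apply: (fun b => bij_comp b (bc_free_bij _ _)).
by exists (mulmx Y) => v; rewrite /= mulmxA ?XY ?YX mul1mx.
Qed.

(* (R_1^n, R_2^n, X) *)
Definition free_datum : PD F := PatchingDatum free_iso_bij.
End FreeDatum.

(* An ideal of R is a submodule of the regular module R^o. *)
Section IdealModule.
Variables (R : comPzRingType) (I : submodClosed R^o).

Definition ideal_module : Type := {x : R^o | x \in I}.
HB.instance Definition _ := SubChoice.on ideal_module.
HB.instance Definition _ := [SubChoice_isSubLmodule of ideal_module by <:].
End IdealModule.

(* Main.v *)
(**
F_F is left adjoint to G_F, and for an adjunction whose functors are mutually
inverse equivalences the unit and the counit are isomorphisms, whatever the given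
natural isomorphisms are. The unit at R identifies R with the fibre product of
R_1 and R_2 over S, so the square is cartesian.

For s in S, let X = [[1, s], [0, 1]] and M = G_F(R_1^2, R_2^2, X), the module of
pairs (v_1, v_2) with X h_1(v_1) = h_2(v_2). The second coordinates of v_1 and v_2
agree in S, which gives a linear map M -> R; let I be its image, an ideal of C. The
kernel of M -> I contains m_0 = ((1, 0), (1, 0)). As the counit M (x) R_i -> R_i^2
is an isomorphism, I (x) R_i is the quotient of R_i^2 by (1, 0), so that
I (x) R_i -> R (x) R_i is an isomorphism. Hence so is I -> R, that is, I = R. A
preimage of 1 in M has the form ((a, 1), (c, 1)) with h_1(a) + s = h_2(c), and so
s = h_1(-a) - h_2(-c).
*)
From HB Require Import structures.
Require Import Defs.
From mathcomp Require Import all_boot all_order all_algebra.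
From mathcomp Require Import boolp.
(* The [hom] and [comp] of Defs must shadow those of MathComp. *)
Import Defs.

Set Implicit Arguments.
Unset Strict Implicit.
Unset Printing Implicit Defensive.

Import GRing.Theory.
Local Open Scope ring_scope.

(** * Equivalences of categories and adjoint equivalences *)

Section FullyFaithful.
Variables (C D : category) (F : functor C D).

Definition full := forall x y (w : hom (F x) (F y)), exists u, fmap F u = w.
Definition faithful := forall x y, injective (@fmap _ _ F x y).

Hypotheses (F_full : full) (F_faithful : faithful).

Lemma fully_faithful_reflects_iso x y (u : hom x y) :
  is_iso (fmap F u) -> is_iso u.
Proof.
move=> [w [wu uw]]; have [v Fv] := F_full w; subst w; exists v.
by split; apply: F_faithful; rewrite fmapM fmap1.
Qed.
End FullyFaithful.

(** Naturality recovers [u] from [fmap G (fmap F u)] by conjugating with the isomorphism [a]. *)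
Lemma nat_iso_faithful (C D : category) (F : functor C D) (G : functor D C) :
  naturally_isomorphic (compF G F) (idF C) -> faithful F.
Proof.
move=> [a [a_iso a_nat]] x y u v /= Fuv; have [b [_ ab]] := a_iso x.
rewrite -[u]compm1 -[v]compm1 -ab !compA.
by have /= <- := a_nat _ _ u; have /= <- := a_nat _ _ v; rewrite Fuv.
Qed.

(** Conjugating [fmap G w] by [a] gives a candidate [u]. Naturality of [a] forces
    [fmap G (fmap F u) = fmap G w], and [G] is faithful because [F G] is isomorphic to the
    identity. *)
Lemma equivalence_full (C D : category) (F : functor C D) (G : functor D C) :
  naturally_isomorphic (compF G F) (idF C) ->
  naturally_isomorphic (compF F G) (idF D) -> full F.
Proof.
move=> [a [a_iso a_nat]] /nat_iso_faithful G_faithful x y w /=.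
have [b [ba ab]] := a_iso x; have [c [ca ac]] := a_iso y.
exists (comp (a y) (comp (fmap G w) b)); apply: G_faithful.
set u := comp _ _; rewrite -[LHS]comp1m -[idm _]ca -compA.
have /= -> := a_nat _ _ u.
by rewrite /u -!compA ba compm1 compA ca comp1m.
Qed.

Section AdjointEquivalence.
Variables (C D : category) (F : functor C D) (G : functor D C).
Hypothesis GF_id : naturally_isomorphic (compF G F) (idF C).
Hypothesis FG_id : naturally_isomorphic (compF F G) (idF D).
Variables (eta : forall x, hom x (G (F x))) (eps : forall y, hom (F (G y)) y).
Hypothesis eta_natural : forall x y (u : hom x y),
  comp (eta y) u = comp (fmap G (fmap F u)) (eta x).
Hypothesis triangleF : forall x, comp (eps (F x)) (fmap F (eta x)) = idm (F x).
Hypothesis triangleG : forall y, comp (fmap G (eps y)) (eta (G y)) = idm (G y).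

(** The inverse is the [v] with [fmap F v = eps (F x)]. One composite is the first triangle identity
    read through the faithful [F]; the other is naturality of [eta] at [v] followed by the second
    triangle identity. *)
Lemma adjoint_equivalence_unit_iso x : is_iso (eta x).
Proof.
have [v Fv] := equivalence_full GF_id FG_id (eps (F x)).
exists v; split; last by rewrite eta_natural Fv triangleG.
by apply: (nat_iso_faithful GF_id); rewrite fmapM fmap1 Fv triangleF.
Qed.

(** By the triangle identity [fmap G (eps y)] is a left inverse of the invertible [eta (G y)], hence
    its inverse; [G], being fully faithful, reflects this isomorphism. *)
Lemma adjoint_equivalence_counit_iso y : is_iso (eps y).
Proof.
apply: (fully_faithful_reflects_iso (F := G)).
- exact: equivalence_full FG_id GF_id.
- exact: nat_iso_faithful FG_id.
have [v [ve ev]] := adjoint_equivalence_unit_iso (G y).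
exists (eta (G y)); split; last exact: triangleG.
suff -> : fmap G (eps y) = v by [].
by rewrite -[LHS]compm1 -ev compA triangleG comp1m.
Qed.
End AdjointEquivalence.

(** * Isomorphisms of modules and patching data; the unit and counit of patching *)

Lemma lin_iso_bij (A : pzRingType) (U V : lmodType A) (u : {linear U -> V}) :
  @is_iso (module_category A) U V u <-> bijective u.
Proof.
split=> [[v [vu uv]]|[v vK uK]].
  have {}vu : lin_comp v u = lin_id U := vu.
  have {}uv : lin_comp u v = lin_id V := uv.
  by exists v => x; rewrite -[LHS]lin_compE ?vu ?uv.
have v_lin : linear v.
  by move=> a x y; apply: (can_inj vK); rewrite linearP !uK.
pose vM := GRing.isLinear.Build A V U *:%R v v_lin.
pose vL : {linear V -> U} := HB.pack v vM.
by exists vL; split; apply: linear_ext.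
Qed.

Section UnitCounit.
Variable F : comm_square.

Section Unit.
Variable M : lmodType (sqR F).

Lemma patching_unit_subproof (m : M) :
  (tens (g1 F) m 1, tens (g2 F) m 1) \in @glue_pred F (F_obj M).
Proof. by apply/glue_predP; rewrite [LHS]F_iso_tens rmorph1 mul1r. Qed.

Definition patching_unit_fun (m : M) : glue (F_obj M) :=
  exist (fun p => p \in @glue_pred F (F_obj M)) _ (patching_unit_subproof m).

Lemma patching_unit_is_linear : linear patching_unit_fun.
Proof.
move=> r m n; apply/val_inj; rewrite linearP /=.
by congr (_, _); rewrite !(tensDl, tensZl, tensZr).
Qed.

HB.instance Definition _ := GRing.isLinear.Build (sqR F) M
  (glue (F_obj M)) *:%R patching_unit_fun patching_unit_is_linear.

Definition patching_unit : {linear M -> glue (F_obj M)} := patching_unit_fun.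
End Unit.

Section Counit.
Variable Y : patching_datum F.

Definition glue_fst (p : glue Y) : restr (g1 F) (pd1 Y) := (val p).1.
Definition glue_snd (p : glue Y) : restr (g2 F) (pd2 Y) := (val p).2.

Lemma glue_fst_is_linear : linear glue_fst.
Proof. by move=> r p q; rewrite /glue_fst linearP. Qed.
Lemma glue_snd_is_linear : linear glue_snd.
Proof. by move=> r p q; rewrite /glue_snd linearP. Qed.

HB.instance Definition _ := GRing.isLinear.Build (sqR F) (glue Y)
  (restr (g1 F) (pd1 Y)) *:%R glue_fst glue_fst_is_linear.
HB.instance Definition _ := GRing.isLinear.Build (sqR F) (glue Y)
  (restr (g2 F) (pd2 Y)) *:%R glue_snd glue_snd_is_linear.

(** On the generators [(p (x) 1) (x) 1] the equation is the gluing condition satisfied by [p]. *)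
Lemma patching_counit_comm x :
  pd_iso Y (bc_map (h1 F) (bc_lift glue_fst) x) =
  bc_map (h2 F) (bc_lift glue_snd) (F_iso (glue Y) x).
Proof.
suff E: lin_comp (pd_iso Y) (bc_map (h1 F) (bc_lift glue_fst)) =
        lin_comp (bc_map (h2 F) (bc_lift glue_snd)) (F_iso (glue Y)).
  by rewrite -[LHS]/(lin_comp _ _ x) E.
apply: bc_ext2 => p; rewrite lin_compE [RHS]lin_compE F_iso_tens.
by rewrite !bc_map_tens !bc_lift_tens1 rmorph1 mul1r; apply/glue_predP/valP.
Qed.

Definition patching_counit : hom (patching_F F (patching_G F Y)) Y :=
  PatchingMorphism (X := F_obj (glue Y)) patching_counit_comm.
End Counit.

Lemma patching_unit_natural (M N : lmodType (sqR F)) (u : {linear M -> N}) :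
  lin_comp (patching_unit N) u = lin_comp (G_map (F_map u)) (patching_unit M).
Proof.
apply: linear_ext => m; apply/val_inj.
by rewrite !lin_compE /= !bc_map_tens.
Qed.

Lemma patching_triangleF (M : lmodType (sqR F)) :
  comp (patching_counit (F_obj M)) (F_map (patching_unit M)) = idm (F_obj M).
Proof.
by apply: patching_morphism_ext; apply: bc_ext => m;
  rewrite lin_compE /= bc_map_tens bc_lift_tens1.
Qed.

Lemma patching_triangleG (Y : patching_datum F) :
  lin_comp (G_map (patching_counit Y)) (patching_unit (glue Y)) = lin_id _.
Proof.
apply: linear_ext => p; apply/val_inj.
by rewrite !lin_compE /= !bc_lift_tens1 -surjective_pairing.
Qed.

Lemma patching_iso_bij (X Y : patching_datum F) (u : patching_morphism X Y) :
  @is_iso (PD F) X Y u <-> bijective (pm1 u) /\ bijective (pm2 u).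
Proof.
split=> [[v [vu uv]]|].
  have E1 := congr1 (@pm1 F _ _) vu; have E1' := congr1 (@pm1 F _ _) uv.
  have E2 := congr1 (@pm2 F _ _) vu; have E2' := congr1 (@pm2 F _ _) uv.
  split; [apply/lin_iso_bij; exists (pm1 v)|apply/lin_iso_bij; exists (pm2 v)];
    by split.
move=> [/lin_iso_bij[v1 [vu1 uv1]] /lin_iso_bij[v2 [vu2 uv2]]].
(* The componentwise inverses respect the gluing maps: cancel the base changes of [u] on both sides
   of its own commuting square. *)
have v_comm x : pd_iso X (bc_map (h1 F) v1 x) = bc_map (h2 F) v2 (pd_iso Y x).
  have K1 z : bc_map (h1 F) (pm1 u) (bc_map (h1 F) v1 z) = z.
    by rewrite -[LHS]/(lin_comp _ _ z) -bc_mapM [lin_comp _ _]uv1 bc_map1.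
  have K2 z : bc_map (h2 F) v2 (bc_map (h2 F) (pm2 u) z) = z.
    by rewrite -[LHS]/(lin_comp _ _ z) -bc_mapM [lin_comp _ _]vu2 bc_map1.
  by rewrite -[LHS]K2 -pm_comm K1.
exists (PatchingMorphism v_comm).
by split; apply: patching_morphism_ext.
Qed.
End UnitCounit.

(** * Consequences for the subcategories [C] and [D] *)

Section Equivalence.
Variables (F : comm_square) (C : lmodType (sqR F) -> Prop).
Variable D : patching_datum F -> Prop.
Hypothesis equivCD :
  @induce_inverse_equivalences (module_category (sqR F)) (PD F)
    (patching_F F) (patching_G F) C D.

(** Since the subcategories are full, the ambient unit and counit are morphisms of them, and the
    triangle identities hold for the restricted functors. *)
Lemma patching_unit_bij M : C M -> bijective (patching_unit M).
Proof.
move=> CM; have [FP [GQ [GF_id FG_id]]] := equivCD.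
apply/lin_iso_bij.
apply: (adjoint_equivalence_unit_iso GF_id FG_id
  (eta := fun x => patching_unit (sval x))
  (eps := fun y => patching_counit (sval y)) _ _ _ (exist _ M CM)).
- by move=> x y u; apply: patching_unit_natural.
- by move=> x; apply: patching_triangleF.
- by move=> y; apply: patching_triangleG.
Qed.

Lemma patching_counit_bij Y : D Y ->
  bijective (pm1 (patching_counit Y)) /\ bijective (pm2 (patching_counit Y)).
Proof.
move=> DY; have [FP [GQ [GF_id FG_id]]] := equivCD.
apply/patching_iso_bij.
apply: (adjoint_equivalence_counit_iso GF_id FG_id
  (eta := fun x => patching_unit (sval x))
  (eps := fun y => patching_counit (sval y)) _ _ _ (exist _ Y DY)).
- by move=> x y u; apply: patching_unit_natural.
- by move=> x; apply: patching_triangleF.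
- by move=> y; apply: patching_triangleG.
Qed.

(** The restriction of [patching_F] to [C] is fully faithful, so a map between objects of [C] can be
    tested after base change to [sqR1 F] and [sqR2 F]. *)
Lemma patching_F_reflects_bij (M N : lmodType (sqR F)) (u : {linear M -> N}) :
  C M -> C N ->
  bijective (bc_map (g1 F) u) -> bijective (bc_map (g2 F) u) -> bijective u.
Proof.
move=> CM CN u1 u2; have [FP [GQ [GF_id FG_id]]] := equivCD.
apply/lin_iso_bij.
apply: (@fully_faithful_reflects_iso _ _ _ (equivalence_full GF_id FG_id)
  (nat_iso_faithful GF_id) (exist _ M CM) (exist _ N CN) u).
by apply/(patching_iso_bij (F_map u)); split.
Qed.
End Equivalence.

(** * Base change of the regular module and of surjections onto ideals *)

Section RegularModule.
Variables (A B : comPzRingType) (f : {rmorphism A -> B}).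

Definition bc_regular_inner (a : A^o) : restr f B^o := f a.

Lemma bc_regular_inner_is_linear : linear bc_regular_inner.
Proof. by move=> a x y; rewrite /bc_regular_inner rmorphD rmorphM. Qed.

HB.instance Definition _ := GRing.isLinear.Build A A^o (restr f B^o) *:%R
  bc_regular_inner bc_regular_inner_is_linear.

Definition bc_regular : {linear base_change f A^o -> B^o} :=
  bc_lift bc_regular_inner.

Lemma bc_regular_tens a b : bc_regular (tens f a b) = b * f a.
Proof. exact: bc_lift_tens. Qed.

(** By [A]-linearity [a (x) b = 1 (x) f a * b]. The injectivity of [bc_regular] that follows lets
    equations in the tensor product be checked in [B]. *)
Lemma bc_regularK : cancel bc_regular (tens f (1 : A^o)).
Proof.
apply: bc_ind => [|x y IHx IHy|a b].
- by rewrite raddf0 tensE scale0r.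
- by rewrite raddfD tensDr IHx IHy.
- by rewrite bc_regular_tens mulrC -tensZl [_ *: _]mulr1.
Qed.
End RegularModule.

Lemma inj_surj_bij (T U : Type) (f : T -> U) :
  injective f -> (forall y, exists x, f x = y) -> bijective f.
Proof.
move=> f_inj f_surj; pose g y := sval (cid (f_surj y)).
have gK : cancel g f by move=> y; rewrite /g; case: cid.
by exists g => // x; apply: f_inj.
Qed.

Lemma bc_map_surj (A B : comPzRingType) (f : {rmorphism A -> B})
    (M N : lmodType A) (q : {linear M -> N}) :
  (forall y, exists x, q x = y) -> forall y, exists x, bc_map f q x = y.
Proof.
move=> q_surj; apply: bc_ind => [|_ _ [x <-] [y <-]|n b].
- by exists 0; rewrite raddf0.
- by exists (x + y); rewrite raddfD.
- by have [m <-] := q_surj n; exists (tens f m b); rewrite bc_map_tens.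
Qed.

(* An element of N (x) B killed by i (x) 1 lifts to M (x) B, where it lies in   *)
(* the kernel of p \o e, which is spanned by m0 (x) 1; but q kills m0.          *)
Lemma bc_map_bij (A B : comPzRingType) (f : {rmorphism A -> B})
    (M N : lmodType A) (V : lmodType B)
    (q : {linear M -> N}) (i : {linear N -> A^o})
    (e : {linear base_change f M -> V}) (p : {linear V -> B^o}) (m0 : M) :
  (forall y, exists x, q x = y) -> bijective e -> (forall b, exists v, p v = b) ->
  (forall m, p (e (tens f m 1)) = f (i (q m))) -> q m0 = 0 ->
  (forall v, p v = 0 -> exists b, v = b *: e (tens f m0 1)) ->
  bijective (bc_map f i).
Proof.
move=> q_surj [e' eK e'K] p_surj pe qm0 ker_p.
have fact x : bc_regular f (bc_map f i (bc_map f q x)) = p (e x).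
  pose r := lin_comp (bc_regular f) (lin_comp (bc_map f i) (bc_map f q)).
  have rE : r = lin_comp p e; last by rewrite -[LHS]/(r x) rE.
  apply: bc_ext => m; rewrite /r !lin_compE !bc_map_tens pe.
  by rewrite bc_regular_tens mul1r.
have surj_q := bc_map_surj (f := f) q_surj.
apply: inj_surj_bij => [|y].
  apply: raddf_inj => y; have [x <-] := surj_q y => iqx.
  have [b eb] : exists b, e x = b *: e (tens f m0 1).
    by apply: ker_p; rewrite -fact iqx raddf0.
  have -> : x = b *: tens f m0 1 by apply: (can_inj eK); rewrite eb linearZ_LR.
  rewrite linearZ_LR bc_map_tens qm0 /= -[tens f 0 1]/(tens1 f 0) raddf0.
  exact: scaler0.
(* Surjectivity: lift the value of [y] in [B] through [p] and [e], then push it along [q];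
   injectivity of [bc_regular] identifies the result with [y]. *)
have [v pv] := p_surj (bc_regular f y); exists (bc_map f q (e' v)).
by apply: (can_inj (@bc_regularK _ _ f)); rewrite fact e'K.
Qed.

(** * The image of a linear form as an ideal *)

Section ImageIdeal.
Variables (R : comPzRingType) (M : lmodType R) (u : {linear M -> R^o}).

Definition image_pred : {pred R^o} := [pred r | `[< exists m, u m = r >]].

Lemma image_pred_submod : submod_closed image_pred.
Proof.
split=> [|a x y /asboolP[m <-] /asboolP[n <-]]; apply/asboolP.
  by exists 0; rewrite raddf0.
by exists (a *: m + n); rewrite linearP.
Qed.

HB.instance Definition _ := GRing.isSubmodClosed.Build R R^o image_pred
  image_pred_submod.

Definition image_ideal : submodClosed R^o := image_pred.

Lemma image_corestr_subproof m : u m \in image_ideal.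
Proof. by apply/asboolP; exists m. Qed.

Definition image_corestr_fun (m : M) : ideal_module image_ideal :=
  exist (fun r => r \in image_ideal) _ (image_corestr_subproof m).

Lemma image_corestr_is_linear : linear image_corestr_fun.
Proof.
by move=> a m n; apply/val_inj; rewrite [RHS]linearP; apply: (linearP u).
Qed.

HB.instance Definition _ := GRing.isLinear.Build R M
  (ideal_module image_ideal) *:%R image_corestr_fun image_corestr_is_linear.

Definition image_corestr : {linear M -> ideal_module image_ideal} :=
  image_corestr_fun.

Lemma image_corestr_surj y : exists m, image_corestr m = y.
Proof. by have /asboolP[m um] := valP y; exists m; apply/val_inj. Qed.
End ImageIdeal.

(** * Coordinates on the glued module of a free datum *)

Definition col_coord (R : comPzRingType) n (i : 'I_n) (v : 'cV[R]_n) : R^o :=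
  v i 0.

Lemma col_coord_is_linear (R : comPzRingType) n i : linear (@col_coord R n i).
Proof. by move=> a v w; rewrite /col_coord !mxE. Qed.

HB.instance Definition _ (R : comPzRingType) n i :=
  GRing.isLinear.Build R 'cV[R]_n R^o *:%R (@col_coord R n i)
    (@col_coord_is_linear R n i).

Section FreeDatumGlue.
Variables (F : comm_square) (n : nat) (X : 'M[sqS F]_n).
Hypothesis Xinv : invertible_mx X.

Lemma free_glueP (v : restr (g1 F) 'cV[sqR1 F]_n * restr (g2 F) 'cV[sqR2 F]_n) :
  v \in @glue_pred F (free_datum Xinv) <->
  X *m map_mx (h1 F) v.1 = map_mx (h2 F) v.2.
Proof.
have E w : bc_free (h2 F) n (free_iso X (tens (h1 F) w 1)) = X *m map_mx (h1 F) w.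
  by rewrite /free_iso !lin_compE bc_free_invK bc_free_tens scale1r.
have E2 w : bc_free (h2 F) n (tens (h2 F) w 1) = map_mx (h2 F) w.
  by rewrite bc_free_tens scale1r.
split=> [/glue_predP|] vX; last apply/glue_predP.
  by rewrite -E -E2; congr (bc_free _ _ _).
by apply: (can_inj (@bc_freeK _ _ (h2 F) n)); rewrite [LHS]E vX E2.
Qed.

(** As [X] preserves the [i]-th coordinate, the [i]-th coordinates of a glued pair agree in [S] and
    come from some [r] in [R]. Injectivity of [sq_phi] makes the choice of [r] linear. *)
Lemma free_glue_coord (i : 'I_n) : cartesian F -> row i X = row i 1%:M ->
  exists u : {linear glue (free_datum Xinv) -> (sqR F)^o}, forall p,
    g1 F (u p) = (val p).1 i 0 /\ g2 F (u p) = (val p).2 i 0.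
Proof.
move=> [phi_inj phi_im] rowX.
have ex (p : glue (free_datum Xinv)) :
    exists r, sq_phi r = ((val p).1 i 0, (val p).2 i 0).
  apply/phi_im; rewrite /sq_psi /=.
  have /free_glueP/(congr1 (row i))/rowP/(_ 0) := valP p.
  rewrite row_mul rowX -row_mul mul1mx !mxE => ->.
  exact: subrr.
pose u p := sval (cid (ex p)).
have uE p : sq_phi (u p) = ((val p).1 i 0, (val p).2 i 0).
  by rewrite /u; case: cid.
have u_lin : linear (u : _ -> (sqR F)^o).
  move=> a p q; apply: phi_inj; rewrite uE linearP /=.
  have [E1 E2] := uE p; have [E3 E4] := uE q.
  by rewrite /sq_phi !mxE !rmorphD !rmorphM E1 E2 E3 E4.
pose uM := GRing.isLinear.Build _ _ _ *:%R (u : _ -> (sqR F)^o) u_lin.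
pose uL : {linear glue (free_datum Xinv) -> (sqR F)^o} := HB.pack u uM.
by exists uL => p; have [E1 E2] := uE p.
Qed.
End FreeDatumGlue.

(** * Transvections of size 2 *)

Section Transvection.
Variables (S : comPzRingType) (s : S).

Definition transvection : 'M[S]_2 := 1%:M + s *: delta_mx 0 1.

Lemma mul_transvection (v : 'cV[S]_2) :
  transvection *m v = v + (s * v 1 0) *: delta_mx 0 0.
Proof.
rewrite mulmxDl mul1mx -scalemxAl -scalerA; congr (_ + _ *: _).
apply/colP => i; rewrite !mxE (bigD1 1) //= big1 ?addr0 => [|j j1].
  by rewrite !mxE !eqxx andbT mulrC.
by rewrite !mxE (negPf j1) andbF mul0r.
Qed.
End Transvection.

(** The inverse has parameter [- s], because [delta_mx 0 1] squares to zero. *)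
Lemma transvection_invertible (S : comPzRingType) (s : S) :
  invertible_mx (transvection s).
Proof.
have E (t : S) : transvection t *m transvection (- t) = 1%:M.
  rewrite /transvection mulmxDl mulmxDr !mulmxDr !mul1mx mulmx1.
  rewrite -scalemxAl -scalemxAr mul_delta_mx_0 // !scaler0 addr0.
  by rewrite scaleNr addrNK.
by exists (transvection (- s)); split; rewrite // -{2}[s]opprK.
Qed.

(** * The square is cartesian and surjective *)

Section Patching.
Variables (F : comm_square) (C : lmodType (sqR F) -> Prop).
Variable D : patching_datum F -> Prop.
Hypothesis equivCD :
  @induce_inverse_equivalences (module_category (sqR F)) (PD F)
    (patching_F F) (patching_G F) C D.
Hypothesis R_in_C : C (sqR F)^o.

Lemma patching_cartesian : cartesian F.
Proof.
have [v uK vK] := patching_unit_bij equivCD R_in_C.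
have tens1_1 (B : comPzRingType) (g : {rmorphism sqR F -> B}) (r : (sqR F)^o) b :
    tens g r 1 = tens g (1 : (sqR F)^o) b -> g r = b.
  move=> /(congr1 (bc_regular g)).
  by rewrite !bc_regular_tens rmorph1 mul1r mulr1.
split=> [r r' [E1 E2]|[a b]].
  (* Both components of the unit at [r] depend only on [g1 F r] and [g2 F r], so its injectivity
     gives that of [sq_phi]. *)
  have tens1_eq (B : comPzRingType) (g : {rmorphism sqR F -> B}) :
      g r = g r' -> tens g (r : (sqR F)^o) 1 = tens g (r' : (sqR F)^o) 1.
    move=> gr; apply: (can_inj (@bc_regularK _ _ g)).
    by rewrite !bc_regular_tens gr.
  apply: (can_inj uK); apply/val_inj.
  by rewrite /= (tens1_eq _ _ E1) (tens1_eq _ _ E2).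
split=> [/eqP|[r [<- <-]]]; last by rewrite /sq_psi /= sq_comm subrr.
rewrite subr_eq0 => /eqP /= hab.
(* A compatible pair [(a, b)] becomes a glued element, and its preimage under the unit is the
   required element of [R]. *)
have ab_glue : (tens (g1 F) (1 : (sqR F)^o) a, tens (g2 F) (1 : (sqR F)^o) b)
    \in @glue_pred F (F_obj (sqR F)^o).
  apply/glue_predP; rewrite [LHS]F_iso_tens /= hab.
  by rewrite [tens (g2 F) _ b]tensE tensZl.
pose p : glue (F_obj (sqR F)^o) :=
  exist (fun p => p \in @glue_pred F _) _ ab_glue.
have /(congr1 val) [E1 E2] := vK p; exists (v p).
by rewrite /sq_phi (tens1_1 _ _ _ _ E1) (tens1_1 _ _ _ _ E2).
Qed.

Hypothesis free_in_D : forall (X : 'M[sqS F]_2) (Xinv : invertible_mx X),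
  D (free_datum Xinv).
Hypothesis ideal_in_C : forall I : submodClosed (sqR F)^o,
  (exists (M : lmodType (sqR F)) (q : {linear M -> ideal_module I}),
     C M /\ (forall y, exists x, q x = y)) ->
  C (ideal_module I).

Lemma patching_surjective : surjective_square F.
Proof.
move=> s; pose X := transvection s; have Xinv := transvection_invertible s.
have cart := patching_cartesian.
have rowX : row 1 X = row 1 1%:M.
  by apply/rowP => j; rewrite !mxE /= mulr0 addr0.
have [u uE] := free_glue_coord Xinv cart rowX.
pose I := image_ideal u.
pose q : {linear _ -> ideal_module I} := image_corestr u.
have q_surj : forall y, exists x, q x = y by apply: image_corestr_surj.
have CI : C (ideal_module I).
  apply: ideal_in_C; exists (glue (free_datum Xinv)), q; split=> //.
  by have [_ [GQ _]] := equivCD; apply/GQ/free_in_D.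
(* The first basis vector is fixed by the transvection, since its second coordinate vanishes. *)
have m0_glue : (delta_mx 0 0, delta_mx 0 0) \in @glue_pred F (free_datum Xinv).
  apply/free_glueP; rewrite mul_transvection /= !map_delta_mx mxE /=.
  by rewrite mulr0 scale0r addr0.
pose m0 : glue (free_datum Xinv) :=
  exist (fun p => p \in @glue_pred F _) _ m0_glue.
have qm0 : q m0 = 0.
  apply/val_inj; apply: cart.1; have [E1 E2] := uE m0.
  by rewrite /sq_phi [g1 F _]E1 [g2 F _]E2 !mxE !rmorph0.
have coord_surj (B : comPzRingType) (b : B) : exists v : 'cV_2, col_coord 1 v = b.
  by exists (const_mx b); rewrite /col_coord mxE.
have coord_ker (B : comPzRingType) (v : 'cV[B]_2) :
    col_coord 1 v = 0 -> v = v 0 0 *: delta_mx 0 0.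
  move=> v1; apply/colP=> i; rewrite !mxE eqxx andbT.
  by case: i => [[|[|//]] ?] //=; rewrite ?mulr1 ?mulr0 -?v1; congr (v _ _);
    apply/val_inj.
have [e1_bij e2_bij] := patching_counit_bij equivCD (free_in_D Xinv).
have e1E m :
    pm1 (patching_counit (free_datum Xinv)) (tens (g1 F) m 1) = (val m).1.
  exact: bc_lift_tens1.
have e2E m :
    pm2 (patching_counit (free_datum Xinv)) (tens (g2 F) m 1) = (val m).2.
  exact: bc_lift_tens1.
(* Both modules lie in [C], so it suffices to treat the two base changes. In each, [e] is a
   component of the counit and [p] the second coordinate, whose kernel is spanned by the image of
   [m0]. *)
have val_bij : bijective (val : {linear ideal_module I -> (sqR F)^o}).
  apply: (patching_F_reflects_bij equivCD CI R_in_C).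
    apply: (bc_map_bij (p := @col_coord (sqR1 F) 2 1) q_surj e1_bij _ _ qm0).
    - exact: coord_surj.
    - move=> m; have [u1 u2] := uE m.
      exact: etrans (congr1 (@col_coord _ _ 1) (e1E m)) (esym u1).
    - move=> v /coord_ker v0; exists (v 0 0).
      exact: etrans v0 (congr1 _ (esym (e1E m0))).
  apply: (bc_map_bij (p := @col_coord (sqR2 F) 2 1) q_surj e2_bij _ _ qm0).
  - exact: coord_surj.
  - move=> m; have [u1 u2] := uE m.
    exact: etrans (congr1 (@col_coord _ _ 1) (e2E m)) (esym u2).
  - move=> v /coord_ker v0; exists (v 0 0).
    exact: etrans v0 (congr1 _ (esym (e2E m0))).
have [w _ wK] := val_bij; have [m qm] := q_surj (w 1).
have um : u m = 1 by rewrite -[LHS]/(val (q m)) qm wK.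
(* The first coordinate of the gluing equation for a preimage [m] of 1 reads [h1 a + s = h2 c], with
   [a] and [c] the first coordinates of its two components. *)
have /free_glueP/colP/(_ 0) := valP m.
rewrite mul_transvection !mxE -(uE m).1 um !rmorph1 !mulr1 => E.
exists (- (val m).1 0 0, - (val m).2 0 0).
by rewrite /sq_psi /= !rmorphN opprK -E addKr.
Qed.
End Patching.

Theorem theorem1p9 (F : comm_square)
    (C : lmodType (sqR F) -> Prop) (D : patching_datum F -> Prop)
    (equivCD :
       @induce_inverse_equivalences (module_category (sqR F)) (PD F)
         (patching_F F) (patching_G F) C D)
    (R_in_C : C (sqR F)^o)
    (free_in_D : forall (X : 'M[sqS F]_2) (Xinv : invertible_mx X),
       D (free_datum Xinv))
    (ideal_in_C : forall I : submodClosed (sqR F)^o,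
       (exists (M : lmodType (sqR F)) (q : {linear M -> ideal_module I}),
          C M /\ (forall y, exists x, q x = y)) ->
       C (ideal_module I)) :
  cartesian F /\ surjective_square F.
Proof.
split; first exact: patching_cartesian equivCD R_in_C.
exact: patching_surjective equivCD R_in_C free_in_D ideal_in_C.
Qed.
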